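(* Let $\mathbb F$ be a totally real algebraic number field with ring of integers $\mathcal O$, and to every embedding $\sigma:\mathbb F\to\mathbb R$ associate an interval $[a_\sigma,b_\sigma]\subset\mathbb R$ ($a_\sigma<b_\sigma$) and a real number $\lambda_\sigma>0$, with $\prod_\sigma\lambda_\sigma=1$. Then for every nonnegative integer $n$ there exists a nonzero polynomial $P_n(T)\in\mathcal O[T]$ of degree at most $n$ such that for each $\sigma$ $$\max_{x\in[a_\sigma,b_\sigma]}|P_n^\sigma(x)|\le\lambda_\sigma\,|\mathrm{discr}\,\mathbb F|^{1/(2[\mathbb F:\mathbb Q])}\,2^{n/(n+1)}(n+1)\Big(\prod_\sigma\frac{b_\sigma-a_\sigma}{4}\Big)^{n/(2[\mathbb F:\mathbb Q])}.$$
   Context: $P^\sigma$ denotes the polynomial obtained by applying $\sigma$ to the coefficients of $P$; $\mathrm{discr}\,\mathbb F$ is the discriminant of $\mathbb F$; products over $\sigma$ run over all embeddings $\mathbb F\to\mathbb R$. *)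

(* Defs.v *)
From Stdlib Require Export Reals.
From HB Require Export structures.
From mathcomp Require Export all_boot all_order all_algebra all_fingroup all_field.
Set Implicit Arguments.
Unset Strict Implicit.
Unset Printing Implicit Defensive.
Export GRing.Theory Num.Theory.
Local Open Scope ring_scope.

Definition integral (L : fieldExtType rat) (x : L) : Prop :=
  exists p : {poly int}, p \is monic /\ root (map_poly (fun z : int => z%:~R) p) x.

Definition is_real_emb (L : fieldExtType rat) (s : L -> R) : Prop :=
  s 1 = R1 /\ (forall x y, s (x + y) = Rplus (s x) (s y))
           /\ (forall x y, s (x * y) = Rmult (s x) (s y)).

Definition integral_basis (L : fieldExtType rat) (d : nat) (w : 'I_d -> L) : Prop :=
  (forall i, integral (w i)) /\
  (forall x : L, integral x -> exists c : 'I_d -> int, x = \sum_(i < d) (c i)%:~R * w i) /\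
  (forall c c' : 'I_d -> int,
      \sum_(i < d) (c i)%:~R * w i = \sum_(i < d) (c' i)%:~R * w i -> forall i, c i = c' i).

Definition detR (d : nat) (M : 'I_d -> 'I_d -> R) : R :=
  \big[Rplus/R0]_(s : {perm 'I_d})
     Rmult (if odd_perm s then Ropp R1 else R1) (\big[Rmult/R1]_(i < d) M i (s i)).

(* discriminant of L computed from an integral basis w and the list of all
   embeddings sigma:  discr = det(sigma_i(w_j))^2 *)
Definition discrF (L : fieldExtType rat) (d : nat) (w : 'I_d -> L)
  (sigma : 'I_d -> L -> R) : R :=
  Rsqr (detR (fun i j => sigma i (w j))).

Definition peval_emb (L : fieldExtType rat) (s : L -> R) (P : {poly L}) (x : R) : R :=
  \big[Rplus/R0]_(j < size P) Rmult (s P`_j) (pow x j).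

(* Main.v *)
Require Import Defs.
From mathcomp Require Import zify ring lra.
From mathcomp Require Import boolp classical_sets reals topology normedtype sequences Rstruct.
Set Implicit Arguments.
Unset Strict Implicit.
Unset Printing Implicit Defensive.
Import Order.TTheory numFieldNormedType.Exports.
Local Open Scope ring_scope.

(* Write [x = (a_s + b_s) / 2 + (b_s - a_s) / 2 * y] with [y] in [[-1, 1]] and expand
   [P^s(x)] in Chebyshev polynomials of [y], which are bounded by 1: it suffices to bound
   each of the [n + 1] Chebyshev coefficients by [lam_s * r], where [lam_s * r * (n + 1)]
   is the bound to be proved.  In terms of the integral coordinates of [P] these are
   [d (n + 1)] linear forms.  Since [x ^+ k] has leading Chebyshev coefficient
   [2 ((b_s - a_s) / 4) ^+ k] for [k > 0], their determinant is
   [sqrt discr ^+ (n + 1) * 2 ^+ (n d) * (prod_s (b_s - a_s) / 4) ^+ (n (n + 1) / 2)]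
   up to sign, that is [r ^+ (d (n + 1))], and it is nonzero by Dedekind's independence of
   embeddings; so Minkowski's theorem on linear forms applies.  The latter is obtained by
   pigeonhole for integral forms, where the determinant is the index of the image lattice
   (Smith normal form), and by rational approximation for real ones. *)

(** * Minkowski's theorem on linear forms *)

(** Pigeonhole: the box [0 <= y i < c i] has more points than there are residues of [y *m U] modulo
    the [e i], and the difference of two colliding points is the required vector. *)
Lemma rV_collision_mod N (e : 'I_N -> nat) (c : 'I_N -> nat) (U : 'M[int]_N) :
  (forall i, 0 < e i)%N -> (\prod_i e i < \prod_i c i)%N ->
  exists y : 'rV[int]_N, y != 0 /\
    (forall i, `|y 0 i| < (c i)%:Z) /\ forall i, (Posz (e i) %| (y *m U) ord0 i)%Z.
Proof.
move=> e_gt0 lt_ec.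
pose T := {dffun forall i, 'I_(c i)}.
pose vec (f : T) : 'rV[int]_N := \row_i (Posz (f i)).
pose res (f : T) : {dffun forall i, 'I_(e i)} :=
  [ffun i => Ordinal (ltn_pmod `|((vec f *m U) ord0 i %% Posz (e i))%Z|%N (e_gt0 i))].
have card_box (b : 'I_N -> nat) : #|{dffun forall i, 'I_(b i)}| = (\prod_i b i)%N.
  rewrite card_dep_ffun foldrE big_map big_enum /=.
  by apply: eq_bigr => i _; rewrite card_ord.
have /injectivePn[f [g neq_fg eq_res]] : ~~ injectiveb res.
  apply/negP => /injectiveP/leq_card; rewrite !card_box.
  by rewrite leqNgt lt_ec.
exists (vec f - vec g); split; last split.
- rewrite subr_eq0; apply: contraNneq neq_fg => eq_vec.
  apply/eqP/ffunP => i; apply/val_inj.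
  by have /rowP/(_ i) := eq_vec; rewrite !mxE => -[].
- move=> i; rewrite !mxE.
  have ltf := ltn_ord (f i); have ltg := ltn_ord (g i).
  by rewrite ltr_distl ltrBlDr -!PoszD !ltz_nat !ltn_addl.
move=> i; rewrite mulmxBl mxE [X in _ + X]mxE -eqz_mod_dvd.
have /ffunP/(_ i) := eq_res; rewrite !ffunE => /(congr1 val) /=.
have e_neq0 : Posz (e i) != 0 by rewrite eqz_nat -lt0n.
have lt_mod (z : int) : (`|(z %% Posz (e i))%Z| < e i)%N.
  by have := ltz_mod z e_neq0; have := modz_ge0 z e_neq0; lia.
rewrite !modn_small // => eq_abs.
have := modz_ge0 ((vec f *m U) 0 i) e_neq0.
have := modz_ge0 ((vec g *m U) 0 i) e_neq0.
move=> ge0g ge0f; apply/eqP.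
by rewrite -(gez0_abs ge0f) eq_abs gez0_abs.
Qed.

(** With [B = L S U] in Smith normal form, [y] lies in the row lattice of [B] as soon as each
    diagonal entry of [S] divides the matching entry of [y U^-1]. These entries have product
    [|det B|] in absolute value. *)
Lemma minkowski_int N (B : 'M[int]_N) (c : 'I_N -> nat) :
  (`|\det B| < \prod_i c i)%N ->
  exists x : 'rV[int]_N, x != 0 /\ forall i, `|(x *m B) 0 i| < (c i)%:Z.
Proof.
have [/det0P[x x0 xB0] lt_c|detB0 lt_c] := boolP (\det B == 0).
  (* A kernel vector works: the [c i] are positive because their product is. *)
  exists x; split=> // i; rewrite xB0 mxE normr0 ltz_nat lt0n.
  by apply: contraTneq lt_c => ci0; rewrite (bigD1 i) //= ci0.
have [L uL [U uU [s _ defB]]] := int_Smith_normal_form B.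
pose d (i : 'I_N) : int := s`_i.
pose S := (\matrix_(i, j) (d i *+ (i == j :> nat))) : 'M[int]_N.
have absU (V : 'M[int]_N) : V \in unitmx -> `|\det V|%N = 1%N.
  by rewrite unitmxE => /orP[]/eqP ->.
have detS : (\prod_(i < N) `|d i|)%N = `|\det B|%N.
  rewrite defB -/S !det_mulmx !abszM (absU L) // (absU U) // mul1n muln1 det_trig.
    rewrite -(big_morph absz abszM absz1).
    by congr absz; apply: eq_bigr => i _; rewrite mxE eqxx.
  by apply/is_trig_mxP => i j ltij; rewrite mxE ltn_eqF.
have s_gt0 (i : 'I_N) : (0 < `|d i|)%N.
  rewrite lt0n; apply: contraNneq detB0 => si0.
  by rewrite -absz_eq0 -detS (bigD1 i) //= si0.
have [|y [y0 [ltyc dvdy]]] := @rV_collision_mod N (fun i => `|d i|%N) c (invmx U) s_gt0.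
  by rewrite detS.
pose z := (\row_i ((y *m invmx U) ord0 i %/ d i)%Z) : 'rV[int]_N.
have defy : y = (z *m invmx L) *m B.
  rewrite defB -/S !mulmxA mulmxKV //.
  suff -> : z *m S = y *m invmx U by rewrite mulmxKV.
  apply/rowP => i; rewrite mxE (bigD1 i) //= big1 ?addr0 => [|j /negPf nij].
    rewrite [S _ _]mxE eqxx mulr1n mxE divzK //; exact: dvdy.
  by rewrite [S _ _]mxE (_ : (j == i :> nat) = false) // mulr0.
exists (z *m invmx L); split; last by rewrite -defy.
by apply: contraNneq y0 => z0; rewrite defy z0 mul0mx.
Qed.

Section RealForms.
Local Open Scope classical_set_scope.

Lemma floor_approx (R : realType) (a : R) q :
  `|a - (Num.floor (q.+1%:R * a))%:~R / q.+1%:R| <= q.+1%:R^-1.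
Proof.
have q_gt0 : 0 < q.+1%:R :> R by rewrite ltr0n.
have le1 := floor_le (q.+1%:R * a).
have lt1 := floorD1_gt (q.+1%:R * a); rewrite intrD in lt1.
have -> : a - (Num.floor (q.+1%:R * a))%:~R / q.+1%:R =
    (q.+1%:R * a - (Num.floor (q.+1%:R * a))%:~R) / q.+1%:R.
  by rewrite mulrBl mulrAC divff ?mul1r ?gt_eqF.
rewrite normrM ger0_norm ?subr_ge0 // gtr0_norm ?invr_gt0 //.
by rewrite ler_piMl ?invr_ge0 ?(ltW q_gt0) // lerBlDl ltW.
Qed.

Lemma cvg_det (R : realType) N (M : nat -> 'M[R]_N) (A : 'M[R]_N) :
  (forall i j, M q i j @[q --> \oo] --> A i j) -> \det (M q) @[q --> \oo] --> \det A.
Proof.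
move=> cvgM_A; apply: cvg_big => [|s _]; first exact: add_continuous.
apply: cvgM; first exact: cvg_cst.
by apply: cvg_big => [|i _ //]; exact: mul_continuous.
Qed.

Lemma near_div_le (R : realType) (b e : R) :
  0 < e -> \forall q \near \oo, b / q.+1%:R <= e.
Proof.
move=> e_gt0; have cvgb : b * harmonic q @[q --> \oo] --> (0 : R).
  by rewrite -(mulr0 b); apply: cvgMl_tmp; exact: cvg_harmonic.
by near do apply: ltW; apply: cvgr_lt cvgb _ _.
Unshelve. all: end_near. Qed.

Lemma norm_mulmx_le (R : realType) N (x : 'rV[R]_N) (D : 'M[R]_N) (e : R) j :
  (forall i, `|D i j| <= e) -> `|(x *m D) 0 j| <= (\sum_i `|x 0 i|) * e.
Proof.
move=> De; rewrite mxE (le_trans (ler_norm_sum _ _ _)) // mulr_suml.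
by apply: ler_sum => i _; rewrite normrM ler_wpM2l.
Qed.

(* The integral theorem applied to [floor (q A)] for large [q]; the solution [x] depends on
   [q], but its l1-norm [X] is bounded independently of [q] since [A] is invertible. *)
Lemma minkowski_eps (R : realType) N (A : 'M[R]_N) (C : 'I_N -> R) (e : R) :
  (0 < N)%N -> 0 < e -> \det A != 0 -> (forall i, 0 < C i) -> `|\det A| <= \prod_i C i ->
  exists x : 'rV[int]_N, x != 0 /\
    forall i, `|(map_mx intr x *m A) 0 i| <= C i + e.
Proof.
move=> N_gt0 e_gt0 detA C_gt0 leAC.
have uA : A \in unitmx by rewrite unitmxE unitfE.
(* Half of [e] makes the determinant inequality strict; the other half absorbs the rounding
   error. *)
pose e2 := e / 2; have e2_gt0 : 0 < e2 by rewrite divr_gt0.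
pose B q : 'M[int]_N := \matrix_(i, j) Num.floor (q.+1%:R * A i j).
pose Bq q : 'M[R]_N := map_mx intr (B q).
pose a := \sum_j \sum_i `|invmx A i j|.
pose G := \sum_i (C i + e2).
have a_ge0 : 0 <= a by do 2![apply: sumr_ge0 => ? _].
have G_ge0 : 0 <= G by apply: sumr_ge0 => i _; rewrite addr_ge0 ?ltW.
have cvgB : \det (q.+1%:R^-1 *: Bq q) @[q --> \oo] --> \det A.
  apply: cvg_det => i j; apply/cvgrPdist_le => d d_gt0.
  have /cvgrPdist_le/(_ _ d_gt0) := @cvg_harmonic R.
  apply: filterS => q; rewrite sub0r normrN ger0_norm ?invr_ge0 // => led.
  rewrite !mxE mulrC; apply: le_trans led; exact: floor_approx.
have lt_detA : `|\det A| < \prod_i (C i + e2).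
  apply: (le_lt_trans leAC); apply: ltr_prod => //.
    by apply/hasP; exists (Ordinal N_gt0); rewrite ?mem_index_enum.
  by move=> i _; rewrite ltW //= ltrDl.
near \oo => q.
have q_gt0 : 0 < q.+1%:R :> R by rewrite ltr0n.
have Ce_ge0 i : 0 <= q.+1%:R * (C i + e2) by rewrite mulr_ge0 // addr_ge0 ?ltW.
(* An integer below this successor is at most the truncation, so the strict integral bound gives
   back [q.+1 * (C i + e2)]. *)
pose c i := (Num.truncn (q.+1%:R * (C i + e2))).+1.
have [|x [x0 ltx]] := @minkowski_int _ (B q) c.
  rewrite -(ltr_nat R) natr_absz intr_norm -det_map_mx -/(Bq q).
  have -> : Bq q = q.+1%:R *: (q.+1%:R^-1 *: Bq q).
    by rewrite scalerA divff ?scale1r ?gt_eqF.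
  rewrite detZ normrM ger0_norm ?exprn_ge0 // natr_prod.
  apply: (@lt_le_trans _ _ (\prod_i (q.+1%:R * (C i + e2)))); last first.
    apply: ler_prod => i _; rewrite Ce_ge0 /= ltW //.
    by have /andP[] := truncn_itv (Ce_ge0 i).
  rewrite big_split /= prodr_const card_ord ltr_pM2l ?exprn_gt0 //.
  by near: q; exact: cvgr_norm_lt cvgB _ lt_detA.
exists x; split=> // i.
pose X := \sum_j `|(map_mx intr x : 'rV[R]__) 0 j|.
pose y : 'rV[R]_N := map_mx intr x *m (q.+1%:R^-1 *: Bq q).
have le_y j : `|y 0 j| <= C j + e2.
  rewrite /y -scalemxAr -map_mxM mxE mxE normrM gtr0_norm ?invr_gt0 //.
  rewrite ler_pdivrMl // -intr_norm.
  have /andP[le_tr _] := truncn_itv (Ce_ge0 j).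
  apply: le_trans le_tr; rewrite pmulrn ler_int -ltzD1.
  by have := ltx j; rewrite /c intS addrC.
have X_ge0 : 0 <= X by exact: sumr_ge0.
have le_xA j : `|(map_mx intr x *m A) 0 j| <= C j + e2 + X / q.+1%:R.
  have -> : map_mx intr x *m A = y + map_mx intr x *m (A - q.+1%:R^-1 *: Bq q).
    by rewrite mulmxBr addrC subrK.
  rewrite mxE (le_trans (ler_normD _ _)) // lerD // norm_mulmx_le // => k.
  by rewrite !mxE mulrC; exact: floor_approx.
(* Recovering [x] from [x A] bounds [X] in terms of itself; for large [q] the term in [X] on the
   right is at most [X / 2], whence [X <= 2 a G]. *)
have leX : X <= a * (G + X / q.+1%:R).
  rewrite /X.
  have {1}-> : map_mx intr x = map_mx intr x *m A *m invmx A :> 'rV[R]_N.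
    by rewrite mulmxK.
  rewrite mulr_suml; apply: ler_sum => j _.
  rewrite mxE (le_trans (ler_norm_sum _ _ _)) // mulr_suml; apply: ler_sum => k _.
  rewrite normrM mulrC ler_wpM2l // (le_trans (le_xA k)) //.
  rewrite lerD2r /G (bigD1 k) //= lerDl sumr_ge0 // => l _.
  by rewrite addr_ge0 ?ltW.
apply: (le_trans (le_xA i)); rewrite [e]splitr addrA lerD2l -/e2.
have small1 : a / q.+1%:R <= 1 / 2 by near: q; apply: near_div_le; rewrite ?divr_gt0.
have small2 : 2 * a * G / q.+1%:R <= e2 by near: q; apply: near_div_le; rewrite ?divr_gt0.
apply: le_trans small2.
rewrite ler_pM2r ?invr_gt0 //.
have leX2 : X <= a * G + X * (1 / 2).
  apply: (le_trans leX); rewrite mulrDr lerD2l [a * (X / _)]mulrCA.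
  by rewrite ler_wpM2l.
lra.
Unshelve. all: end_near. Qed.

End RealForms.

(* The approximate solutions [x] for [e <= 1] lie in a fixed box, where the excess
   over [C] attains its minimum; this minimum is at most every [e > 0]. *)
Lemma minkowski_linear_forms (R : realType) N (A : 'M[R]_N) (C : 'I_N -> R) :
  (0 < N)%N -> \det A != 0 -> (forall i, 0 < C i) -> `|\det A| <= \prod_i C i ->
  exists x : 'rV[int]_N, x != 0 /\
    forall i, `|(map_mx intr x *m A) 0 i| <= C i.
Proof.
move=> N_gt0 detA C_gt0 leAC.
have uA : A \in unitmx by rewrite unitmxE unitfE.
pose K := (Num.truncn (\sum_j \sum_i (C i + 1) * `|invmx A i j|)).+1.
have leK (x : 'rV[int]_N) :
    (forall i, `|(map_mx intr x *m A) 0 i| <= C i + 1) -> forall j, `|x 0 j| <= K%:Z.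
  move=> lex j; rewrite -(ler_int R) intr_norm.
  have -> : (x 0 j)%:~R = (map_mx intr x *m A *m invmx A) 0 j :> R.
    by rewrite mulmxK ?mxE.
  have sum_ge0 (l : 'I_N) : 0 <= \sum_i (C i + 1) * `|invmx A i l|.
    by apply: sumr_ge0 => i _; rewrite mulr_ge0 ?addr_ge0 // ltW.
  apply: (@le_trans _ _ (\sum_i (C i + 1) * `|invmx A i j|)).
    rewrite mxE (le_trans (ler_norm_sum _ _ _)) //.
    by apply: ler_sum => i _; rewrite normrM ler_wpM2r.
  rewrite -pmulrn ltW //; apply: le_lt_trans (truncnS_gt _).
  by rewrite [leRHS](bigD1 j) //= lerDl sumr_ge0.
(* Shifting by [K] encodes the box [[-K, K]^N] as a finite type, over which a minimum exists. *)
pose vec (f : {ffun 'I_N -> 'I_(2 * K).+1}) : 'rV[int]_N := \row_i (Posz (f i) - K%:Z).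
pose excess f := \big[Num.max/0]_i (`|(map_mx intr (vec f) *m A) 0 i| - C i).
have near_sol (e : R) : 0 < e -> e <= 1 -> exists f, vec f != 0 /\ excess f <= e.
  move=> e_gt0 e_le1; have [x [x0 lex]] := minkowski_eps N_gt0 e_gt0 detA C_gt0 leAC.
  have vecx : vec [ffun i => inord `|x 0 i + K%:Z|] = x.
    apply/rowP => i; rewrite !mxE ffunE.
    have : `|x 0 i| <= K%:Z.
      by apply: leK => j; apply: (le_trans (lex j)); rewrite lerD2l.
    rewrite ler_norml => /andP[le1 le2]; rewrite inordK; last by lia.
    by lia.
  exists [ffun i => inord `|x 0 i + K%:Z|]; rewrite vecx; split=> //.
  rewrite /excess vecx; apply/bigmax_leP; split=> [|i _]; first exact: ltW.
  by rewrite lerBlDl.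
have [f0 [f0_neq0 _]] := near_sol 1 ltr01 (lexx _).
pose f := [arg min_(f < f0 | vec f != 0) excess f]%O.
have [vf0 minf] : vec f != 0 /\ forall g, vec g != 0 -> excess f <= excess g.
  by rewrite /f; case: arg_minP.
exists (vec f); split=> // i.
have : excess f <= 0.
  rewrite leNgt; apply/negP => ex_gt0.
  have min_gt0 : 0 < Num.min 1 (excess f / 2) by rewrite lt_min ltr01 divr_gt0.
  have min_le1 : Num.min 1 (excess f / 2) <= 1 by rewrite ge_min lexx.
  have [g [g0 leg]] := near_sol _ min_gt0 min_le1.
  have := le_trans (minf g g0) leg; rewrite le_min => /andP[_]; lra.
by move=> /bigmax_leP[_ /(_ i isT)]; rewrite subr_le0.
Qed.

(** * Determinants of maps on matrices *)

(* A permutation contributing to the Leibniz formula does not increase [r], while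
   preserving the sum of all its values; so it is the identity. *)
Lemma det_trig_rank (R : idomainType) N (A : 'M[R]_N) (r : 'I_N -> nat) :
  (forall u v, A u v != 0 -> u = v \/ (r v < r u)%N) -> \det A = \prod_u A u u.
Proof.
move=> trigA; rewrite /determinant (bigD1 1%g) //= odd_perm1 mul1r.
rewrite [X in _ + X]big1 ?addr0 => [|s s_neq1]; first by apply: eq_bigr => i; rewrite perm1.
apply/eqP; rewrite mulf_eq0 signr_eq0 /=; apply: contraNT s_neq1 => /prodf_neq0 nzA.
have le_r u : (r (s u) <= r u ?= iff (s u == u))%N.
  split; first by have [{2}->|/ltnW] := trigA _ _ (nzA u isT).
  have [<-|lt_r] := trigA _ _ (nzA u isT); first by rewrite !eqxx.
  by rewrite ltn_eqF //; apply/esym/eqP => su; rewrite su ltnn in lt_r.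
have [_] := leqif_sum (fun u (_ : predT u) => le_r u).
rewrite [X in _ == X](reindex_inj (@perm_inj _ s)) eqxx => /esym/forallP fix_s.
by apply/eqP/permP => u; rewrite perm1; apply/eqP; exact: fix_s.
Qed.

Lemma prod_mxvec_index (R : comNzRingType) m d (F : 'I_(m * d) -> R) :
  \prod_u F u = \prod_i \prod_j F (mxvec_index i j).
Proof.
by rewrite (reindex _ (curry_mxvec_bij _ _)) pair_bigA; apply: eq_bigr => -[].
Qed.

Section BlockDeterminant.
Variables (R : fieldType) (m d : nat).

(** On matrix units, right multiplication by [B] is block diagonal with [m] copies of [B]. *)
Lemma lin_mulmxrE (B : 'M[R]_d) (i k : 'I_m) (j l : 'I_d) :
  lin_mulmxr B (mxvec_index i j) (mxvec_index k l) = B j l *+ (i == k).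
Proof.
rewrite mxE /= mxvecE vec_mx_delta mxE (bigD1 j) //= big1 => [|j' /negPf nj].
  by rewrite addr0 mxE eqxx andbT eq_sym mulr_natl.
by rewrite mxE nj andbF mul0r.
Qed.

Lemma det_lin_mulmxrM (A B : 'M[R]_d) :
  \det (lin_mulmxr (A *m B) : 'M_(m * d)) =
  \det (lin_mulmxr A : 'M_(m * d)) * \det (lin_mulmxr B : 'M_(m * d)).
Proof.
rewrite -det_mulmx; congr (\det _); apply/row_matrixP => u.
by rewrite !rowE mulmxA !mul_rV_lin /= mxvecK mulmxA.
Qed.

(** The rank [r] lets one statement serve both lower and upper triangular matrices; pairs of indices
    are ranked by their column. *)
Lemma det_lin_mulmxr_trig (B : 'M[R]_d) (r : 'I_d -> nat) :
  (forall j l, B j l != 0 -> j = l \/ (r l < r j)%N) ->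
  \det (lin_mulmxr B : 'M_(m * d)) = \det B ^+ m.
Proof.
move=> trigB; have [f _ fK] := curry_mxvec_bij m d.
rewrite (@det_trig_rank _ _ _ (fun u => r (f u).2)) => [|u v].
  rewrite (det_trig_rank trigB) prod_mxvec_index -[m in RHS]card_ord -prodr_const.
  by apply: eq_bigr => i _; apply: eq_bigr => j _; rewrite lin_mulmxrE eqxx mulr1n.
rewrite -{1}[u]fK // -{1}[v]fK //=.
case: (f u) (fK u isT) => i j /= <-; case: (f v) (fK v isT) => k l /= <-.
rewrite lin_mulmxrE; case: (i =P k) => [->|_]; last by rewrite eqxx.
by move=> /trigB[->|]; [left|right].
Qed.

(** Transposition inverts the permutation, so the square is the determinant of the map attached to
    the identity. The sign is left open, since only absolute values matter. *)
Lemma det_lin_mulmxr_perm (P : 'M[R]_d) : is_perm_mx P ->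
  \det (lin_mulmxr P : 'M_(m * d)) ^+ 2 = 1.
Proof.
case/is_perm_mxP => s ->.
have tr_lin : lin_mulmxr (perm_mx s^-1) = (lin_mulmxr (perm_mx s))^T :> 'M[R]_(m * d).
  apply/matrixP => u v; rewrite [RHS]mxE.
  case/mxvec_indexP: u => i j; case/mxvec_indexP: v => k l.
  by rewrite !lin_mulmxrE -tr_perm_mx mxE eq_sym.
rewrite expr2 -{2}det_tr -tr_lin -det_lin_mulmxrM -perm_mxM mulgV perm_mx1.
rewrite (@det_lin_mulmxr_trig _ (fun=> 0%N)) ?det1 ?expr1n // => j l.
by rewrite mxE; case: (j =P l) => [->|]; [left|rewrite eqxx].
Qed.

End BlockDeterminant.

(** The decomposition [P B = L U] reduces this to the triangular and permutation cases. *)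
Lemma norm_det_lin_mulmxr (R : realFieldType) m d (B : 'M[R]_d) : (0 < d)%N ->
  `|\det (lin_mulmxr B : 'M_(m * d))| = `|\det B| ^+ m.
Proof.
case: d B => [//|d] B _.
have := cormen_lup_correct B; have := cormen_lup_perm B.
have := @cormen_lup_lower _ _ B; have := @cormen_lup_upper _ _ B.
case: (cormen_lup B) => [[P L] U] /= upU lowL permP defB.
have norm1 (x : R) : x ^+ 2 = 1 -> `|x| = 1.
  by move/eqP; rewrite sqrf_eq1 => /orP[]/eqP->; rewrite ?normrN normr1.
have detP : `|\det P| = 1.
  by case/is_perm_mxP: permP => s ->; rewrite det_perm normrX normrN1 expr1n.
have normB : `|\det B| = `|\det L * \det U|.
  by rewrite -det_mulmx -[L *m U]/(L * U) -defB det_mulmx normrM detP mul1r.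
rewrite normB -normrX exprMn.
rewrite -(@det_lin_mulmxr_trig _ m _ L (fun j => j)); last first.
  move=> j l; have [lt_lj|le_jl] := ltnP l j; first by right.
  by rewrite lowL //; case: (j =P l) => [->|]; [left|rewrite eqxx].
(* For the upper triangular factor the rank reverses the order of the indices. *)
rewrite -(@det_lin_mulmxr_trig _ m _ U (fun j => d.+1 - j)%N); last first.
  move=> j l; have [lt_lj|lt_jl|eq_jl] := ltngtP l j.
  - by rewrite upU ?eqxx.
  - by right; rewrite ltn_sub2l.
  by left; apply/val_inj.
rewrite -det_lin_mulmxrM -[L *m U]/(L * U) -defB det_lin_mulmxrM normrM.
by rewrite (norm1 _ (det_lin_mulmxr_perm _ permP)) mul1r.
Qed.

Section ColumnCombination.
Variables (R : fieldType) (m d : nat) (t : 'I_d -> 'I_m -> 'I_m -> R).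

(** Each column has its own change of basis [t s]. In the application, column [s] holds the monomial
    coefficients of the conjugate of [P] by [sigma s], and the result holds its Chebyshev
    coefficients. *)
Definition colcomb (Y : 'M[R]_(m, d)) : 'M[R]_(m, d) :=
  \matrix_(k, s) \sum_j t s j k * Y j s.

Fact colcomb_is_linear : linear colcomb.
Proof.
move=> a X Y; apply/matrixP => k s; rewrite !mxE mulr_sumr -big_split /=.
by apply: eq_bigr => j _; rewrite !mxE mulrDr mulrCA.
Qed.

HB.instance Definition _ := GRing.isLinear.Build R _ _ _ colcomb colcomb_is_linear.

Lemma lin_colcombE (j k : 'I_m) (s s' : 'I_d) :
  lin_mx colcomb (mxvec_index j s) (mxvec_index k s') = t s j k *+ (s == s').
Proof.
rewrite mxE /= mxvecE vec_mx_delta mxE (bigD1 j) //= big1 => [|j' /negPf nj].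
  by rewrite addr0 mxE eqxx /= eq_sym mulr_natr; case: eqP => [->|].
by rewrite mxE nj mulr0.
Qed.

(** Columns do not interact, so ranking pairs by their row index makes the map triangular. *)
Lemma det_lin_colcomb : (forall s j k, t s j k != 0 -> (k <= j)%N) ->
  \det (lin_mx colcomb) = \prod_k \prod_s t s k k.
Proof.
move=> trig_t; have [f _ fK] := curry_mxvec_bij m d.
rewrite (@det_trig_rank _ _ _ (fun u => (f u).1)) => [|u v].
  rewrite prod_mxvec_index.
  by apply: eq_bigr => i _; apply: eq_bigr => j _; rewrite lin_colcombE eqxx mulr1n.
rewrite -{1}[u]fK // -{1}[v]fK //=.
case: (f u) (fK u isT) => j s /= <-; case: (f v) (fK v isT) => k s' /= <-.
rewrite lin_colcombE; case: (s =P s') => [<-|_]; last by rewrite eqxx.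
by move=> /trig_t; rewrite leq_eqVlt => /predU1P[/val_inj ->|]; [left|right].
Qed.

End ColumnCombination.

(** On flattened matrices the forms are right multiplication by [W] followed by [colcomb t], so
    their determinant is the product of the two computed above. *)
Lemma minkowski_matrix_forms (R : realType) n d (t : 'I_d -> 'I_n.+1 -> 'I_n.+1 -> R)
    (W : 'M[R]_d) (C : 'I_n.+1 -> 'I_d -> R) :
  (0 < d)%N -> (forall s j k, t s j k != 0 -> (k <= j)%N) -> (forall s k, t s k k != 0) ->
  \det W != 0 -> (forall k s, 0 < C k s) ->
  `|\det W| ^+ n.+1 * \prod_k \prod_s `|t s k k| <= \prod_k \prod_s C k s ->
  exists c : 'M[int]_(n.+1, d), c != 0 /\
    forall k s, `|\sum_j t s j k * (map_mx intr c *m W) j s| <= C k s.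
Proof.
move=> d_gt0 trig_t nz_t nzW C_gt0 leC.
pose A : 'M[R]_(n.+1 * d) := lin_mulmxr W *m lin_mx (colcomb t).
pose CC : 'rV[R]_(n.+1 * d) := mxvec (\matrix_(k, s) C k s).
have detA : `|\det A| = `|\det W| ^+ n.+1 * \prod_k \prod_s `|t s k k|.
  rewrite det_mulmx normrM norm_det_lin_mulmxr // det_lin_colcomb // normr_prod.
  by congr (_ * _); apply: eq_bigr => k _; rewrite normr_prod.
have [] := @minkowski_linear_forms R _ A (CC 0).
- by rewrite muln_gt0 d_gt0.
- rewrite -normr_gt0 detA mulr_gt0 ?exprn_gt0 ?normr_gt0 //.
  by do 2![apply: prodr_gt0 => ? _]; rewrite normr_gt0.
- by case/mxvec_indexP => k s; rewrite mxvecE mxE.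
- rewrite detA prod_mxvec_index; apply: (le_trans leC).
  rewrite le_eqVlt; apply/orP; left; apply/eqP; do 2![apply: eq_bigr => ? _].
  by rewrite mxvecE mxE.
move=> x [x0 lex]; exists (vec_mx x); split.
  by apply: contraNneq x0 => x0; rewrite -[x]vec_mxK x0 linear0.
move=> k s; have := lex (mxvec_index k s); rewrite [X in _ <= X]mxvecE mxE.
have -> : map_mx intr x = mxvec (map_mx intr (vec_mx x)) :> 'rV[R]_(n.+1 * d).
  by rewrite -map_mxvec vec_mxK.
by rewrite mulmxA !mul_vec_lin mxvecE mxE.
Qed.

(** * Chebyshev expansions *)

(** Take [T k = cos (k * acos y)]; the recurrence is the addition formula. Only the values at one
    point [y] matter, so a sequence of reals replaces the polynomials. *)
Lemma chebyshev_values (y : R) : `|y| <= 1 ->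
  exists T : nat -> R, [/\ T 0%N = 1, T 1%N = y,
    forall k, T k.+2 = 2 * y * T k.+1 - T k & forall k, `|T k| <= 1].
Proof.
rewrite ler_norml => /andP[/RleP ge_y /RleP le_y].
have cos_u : cos (acos y) = y by apply: cos_acos.
pose arg (k : nat) : R := k%:R * acos y.
exists (fun k => cos (arg k)); split=> [|| k | k].
- by rewrite /arg mul0r cos_0.
- by rewrite /arg mul1r.
- have -> : arg k.+2 = arg k.+1 + acos y by rewrite /arg; ring.
  have -> : arg k = arg k.+1 + - acos y by rewrite /arg; ring.
  by rewrite !cosD cos_neg sin_neg cos_u; rewrite RoppE; ring.
by have [/RleP ? /RleP ?] := COS_bound (arg k); rewrite ler_norml; apply/andP.
Qed.

(* [cheb_coef m h j k] is the coefficient of the k-th Chebyshev polynomial in the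
   expansion of [(m + h y) ^+ j] as a polynomial in [y]. *)
Fixpoint cheb_coef (F : fieldType) (m h : F) (j k : nat) : F :=
  if j is j'.+1 then
    m * cheb_coef m h j' k +
    h / 2 * ((if k is k'.+1 then cheb_coef m h j' k' *+ (k' == 0%N).+1 else 0)
             + cheb_coef m h j' k.+1)
  else (k == 0%N)%:R.

Section ChebyshevCoefficients.
Variables (F : realFieldType) (m h : F).
Local Notation coef := (cheb_coef m h).

Lemma cheb_coefS j k : coef j.+1 k = m * coef j k +
  h / 2 * ((if k is k'.+1 then coef j k' *+ (k' == 0%N).+1 else 0) + coef j k.+1).
Proof. by []. Qed.

Lemma cheb_coef_eq0 j k : (j < k)%N -> coef j k = 0.
Proof.
elim: j k => [|j IHj] [|k] // ltjk; have lt_jk1 := leqW ltjk.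
by rewrite /= !IHj ?mul0rn ?addr0 ?mulr0 ?addr0 // ltnW.
Qed.

(** Each multiplication by [h y] carries the top coefficient up with factor [h / 2], except the
    first, where [y T_0 = T_1] gives [h]; hence the extra factor 2 for [j > 0]. *)
Lemma cheb_coef_diag j : coef j j = (h / 2) ^+ j *+ (if j is 0 then 1 else 2).
Proof.
elim: j => [|[|j] IHj]; first by rewrite expr0.
  by rewrite /= !mulr0 add0r addr0 mulr_natr expr1.
rewrite cheb_coefS IHj !cheb_coef_eq0 // mulr0 add0r addr0 mulr1n.
by rewrite mulrnAr -exprS.
Qed.

Lemma cheb_expansion (y : F) (T : nat -> F) n j : T 0%N = 1 -> T 1%N = y ->
    (forall k, T k.+2 = 2 * y * T k.+1 - T k) -> (j < n)%N ->
  (m + h * y) ^+ j = \sum_(k < n) coef j k * T k.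
Proof.
move=> T0 T1 TS; elim: j n => [|j IHj] [//|n] ltjn.
  by rewrite big_ord_recl /= T0 mulr1n mul1r big1 ?addr0 // => i _; rewrite mulr0n mul0r.
(* [pT k] is [T (k - 1)], with value 0 at [k = 0]: there [2 y T_0 = 2 T_1] replaces
   [2 y T_k = T_(k+1) + T_(k-1)]. *)
pose pT k := if k is k'.+1 then T k' else 0.
have mulT k : (m + h * y) * T k = m * T k + h / 2 * (T k.+1 *+ (k == 0%N).+1 + pT k).
  by case: k => [|k]; rewrite ?T0 ?T1 ?TS /=; field.
have extend (G : nat -> F) :
    \sum_(k < n) coef j k * G k = \sum_(k < n.+2) coef j k * G k.
  by rewrite !big_ord_recr /= !cheb_coef_eq0 ?mul0r ?addr0 // ltnW.
have sum_pT : \sum_(k < n) coef j k * pT k = \sum_(k < n.+1) coef j k.+1 * T k.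
  by rewrite extend big_ord_recl mulr0 add0r.
have sum_T : \sum_(k < n) coef j k * T k = \sum_(k < n.+1) coef j k * T k.
  by rewrite big_ord_recr /= cheb_coef_eq0 // mul0r addr0.
rewrite exprS (IHj n) // mulr_sumr.
transitivity (m * (\sum_(k < n) coef j k * T k) + h / 2 *
    (\sum_(k < n) coef j k * (T k.+1 *+ (k == 0%N :> nat).+1)
     + \sum_(k < n) coef j k * pT k)).
  rewrite mulrDr !mulr_sumr -!big_split /=; apply: eq_bigr => k _.
  by rewrite mulrCA mulT; ring.
rewrite sum_T sum_pT mulrDr !mulr_sumr.
have -> : \sum_(k < n) h / 2 * (coef j k * (T k.+1 *+ (k == 0%N :> nat).+1)) =
    \sum_(k < n.+1) h / 2 * ((if k : nat is k'.+1 then coef j k' *+ (k' == 0%N).+1 else 0) * T k).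
  rewrite [RHS]big_ord_recl mul0r mulr0 add0r; apply: eq_bigr => k _.
  by rewrite mulrnAl mulrnAr.
rewrite -!big_split /=; apply: eq_bigr => k _.
by rewrite -mulrDr -mulrDl !mulrA -mulrDl.
Qed.

End ChebyshevCoefficients.

(** * Embeddings and integral bases *)

(* Dedekind's argument: comparing the relation at [z * x] with [sigma_i z] times the
   relation at [x] removes the term [i]. *)
Lemma dedekind_independence (A : pzRingType) (K : idomainType) (I : eqType) (sigma : I -> A -> K)
    (r : seq I) (v : I -> K) :
  (forall i, sigma i 1 = 1) -> (forall i, {morph sigma i : x y / x * y}) ->
  (forall i j, sigma i =1 sigma j -> i = j) -> uniq r ->
  (forall x, \sum_(i <- r) v i * sigma i x = 0) -> forall i, i \in r -> v i = 0.
Proof.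
move=> s1 sM s_inj; elim: r v => [|i r IHr] v //= /andP[i_notin uniq_r] rel.
have v_r j : j \in r -> v j = 0.
  move=> jr; have neq_ij : i <> j by move=> eq_ij; rewrite eq_ij jr in i_notin.
  have [z /eqP neq_z] : exists z, sigma i z <> sigma j z.
    apply: contrapT => eq_s; apply: neq_ij; apply: s_inj => z.
    by apply: contrapT => neq_z; apply: eq_s; exists z.
  have relz x : \sum_(l <- r) (v l * (sigma l z - sigma i z)) * sigma l x = 0.
    have tail y : \sum_(l <- r) v l * sigma l y = - (v i * sigma i y).
      by apply/eqP; rewrite -addr_eq0 addrC; apply/eqP; have := rel y; rewrite big_cons.
    transitivity ((- (v i * sigma i (z * x))) - sigma i z * - (v i * sigma i x)); last first.
      by rewrite mulrN opprK sM mulrCA addNr.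
    rewrite -!tail mulr_sumr -sumrB; apply: eq_bigr => l _.
    by rewrite sM mulrBr mulrBl mulrA [in RHS]mulrCA mulrA.
  have /eqP := IHr _ uniq_r relz j jr.
  by rewrite mulf_eq0 subr_eq0 => /orP[/eqP //|/eqP eqz]; rewrite eqz eqxx in neq_z.
move=> j; rewrite inE => /predU1P[->|/v_r //].
have := rel 1; rewrite big_cons s1 mulr1 big_seq big1 ?addr0 // => l lr.
by rewrite v_r ?mul0r.
Qed.

Lemma real_emb_rmorphism (L : fieldExtType rat) (s : L -> R) :
  is_real_emb s -> exists f : {rmorphism L -> R}, f =1 s.
Proof.
case=> s1 [sD sM].
have s0 : s 0 = 0 by apply: (addrI (s 0)); rewrite -[LHS]sD !addr0.
have sB : {morph s : x y / x - y}.
  by move=> x y; apply: (addIr (s y)); rewrite subrK -[LHS]sD subrK.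
pose sAdd := GRing.isZmodMorphism.Build L R s sB.
pose sMul := GRing.isMonoidMorphism.Build L R s (conj s1 sM).
pose f : {rmorphism L -> R} := HB.pack s sAdd sMul.
by exists f.
Qed.

Lemma real_emb_sumz (L : fieldExtType rat) (s : L -> R) d (w : 'I_d -> L) (c : 'I_d -> int) :
  is_real_emb s -> s (\sum_i (c i)%:~R * w i) = \sum_i (c i)%:~R * s (w i).
Proof.
move=> /real_emb_rmorphism[f fE]; rewrite -fE rmorph_sum /=.
by apply: eq_bigr => i _; rewrite rmorphM rmorph_int -fE.
Qed.

(* Common denominators come from clearing those of the polynomial with coefficients [k]. *)
Lemma common_denominator d (k : 'I_d -> rat) :
  exists (a : int) (q : 'I_d -> int), a != 0 /\ forall i, (q i)%:~R = a%:~R * k i.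
Proof.
have [q [a a0 defq]] := rat_poly_scale (\poly_(i < d) (if insub i is Some j then k j else 0)).
exists a, (fun i => q`_i); split=> // i.
have /(congr1 (fun p : {poly rat} => p`_i)) := defq.
rewrite coef_poly ltn_ord insubT /= => [|Hi]; first exact: ltn_ord.
rewrite coefZ coef_map /= (_ : Sub _ _ = i); last exact/val_inj.
by move=> ->; rewrite mulrA divff ?mul1r // intr_eq0.
Qed.

Section IntegralBasis.
Variables (L : fieldExtType rat) (d : nat) (w : 'I_d -> L).
Hypothesis hd : \dim {:L} = d.
Hypothesis hw : integral_basis w.

Lemma integral_basis_eq0 (c : 'I_d -> int) :
  \sum_(i < d) (c i)%:~R * w i = 0 -> forall i, c i = 0.
Proof.
case: hw => _ [_ inj_w] sum0; apply: inj_w; rewrite sum0 big1 // => i _.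
by rewrite mul0r.
Qed.

(** Clearing denominators turns a rational relation between the [w i] into an integral one, so they
    are free over the rationals; being as many as the dimension, they span. *)
Lemma integral_basis_span (x : L) :
  exists (a : int) (q : 'I_d -> int), a != 0 /\ a%:~R * x = \sum_(i < d) (q i)%:~R * w i.
Proof.
pose X := [tuple w i | i < d].
have scalez (z : int) (u : L) : z%:~R * u = z%:~R *: u by rewrite mulrzl scaler_int.
have freeX : free X.
  apply/freeP => k sum0 i; have [a [q [a0 defq]]] := common_denominator k.
  have /integral_basis_eq0 q0 : \sum_(i < d) (q i)%:~R * w i = 0.
    transitivity (a%:~R *: \sum_(i < d) k i *: X`_i); last by rewrite sum0 scaler0.
    rewrite scaler_sumr; apply: eq_bigr => j _.
    by rewrite scalez defq scalerA -tnth_nth tnth_mktuple.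
  apply/eqP; have /eqP := defq i; rewrite q0 eq_sym mulf_eq0 intr_eq0.
  by rewrite (negPf a0).
have spanX : <<X>>%VS = fullv.
  by apply/eqP; rewrite eqEdim subvf /= (eqP freeX) size_tuple hd.
have [a [q [a0 defq]]] := common_denominator (fun i => coord X i x).
exists a, q; split=> //.
have {1}-> : x = \sum_(i < d) coord X i x *: X`_i by apply: coord_span; rewrite spanX memvf.
rewrite mulr_sumr; apply: eq_bigr => j _.
by rewrite [in LHS]scalez scalez scalerA defq -tnth_nth tnth_mktuple.
Qed.

(** A vector in the left kernel is a relation between the embeddings on the basis, hence on all of
    [L] up to a nonzero integer factor, which Dedekind's argument excludes. *)
Lemma det_real_emb_neq0 (sigma : 'I_d -> L -> R) :
    (forall i, is_real_emb (sigma i)) ->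
    (forall i j, (forall x, sigma i x = sigma j x) -> i = j) ->
  \det (\matrix_(i, j) sigma i (w j)) != 0.
Proof.
move=> hemb hinj; apply/det0P => -[v v0 rel].
case/eqP: v0; apply/rowP => i; rewrite mxE.
apply: (@dedekind_independence L R _ sigma (index_enum 'I_d) (v 0)) => //.
- by move=> j; case: (hemb j).
- by move=> j; case: (hemb j) => _ [].
- exact: index_enum_uniq.
- move=> x; have [a [q [a0 defx]]] := integral_basis_span x.
  have aR : a%:~R != 0 :> R by rewrite intr_eq0.
  apply: (mulfI aR); rewrite mulr0 mulr_sumr.
  transitivity (\sum_j (v *m (\matrix_(i, j) sigma i (w j))) 0 j * (q j)%:~R).
    under [RHS]eq_bigr do rewrite mxE mulr_suml.
    rewrite exchange_big; apply: eq_bigr => j _ /=.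
    have /(congr1 (sigma j)) := defx; rewrite real_emb_sumz //.
    have [f fE] := real_emb_rmorphism (hemb j).
    rewrite -{1}fE rmorphM rmorph_int fE mulrCA => ->.
    by rewrite mulr_sumr; apply: eq_bigr => l _; rewrite mxE mulrCA mulrC -mulrA.
  by rewrite big1 // => j _; rewrite rel mxE mul0r.
- exact: mem_index_enum.
Qed.

Lemma integral_sumz (c : 'I_d -> int) : integral (\sum_(i < d) (c i)%:~R * w i).
Proof.
have intP (x : L) : integral x <-> integralOver (intr : int -> L) x.
  by split=> [[p [? ?]]|[p ? ?]]; exists p.
apply/intP; apply: big_ind => [|x y|i _].
- exact: integral0.
- exact: integral_add.
by apply: integral_mul; [exact: integral_id|case: hw => int_w _; apply/intP].
Qed.

End IntegralBasis.

Lemma Rpower_divn_expr (x : R) p q : 0 < x -> (0 < q)%N ->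
  Rpower x (Rdiv (INR p) (INR q)) ^+ q = x ^+ p.
Proof.
move=> /RltP x_gt0 q_gt0; rewrite -!RpowE -Rpower_pow; last exact: exp_pos.
rewrite Rpower_mult -Rpower_pow //; congr Rpower.
by rewrite RmultE RdivE divfK // INRE pnatr_eq0 -lt0n.
Qed.

(** * The linear forms of the theorem *)

Lemma discrFE (L : fieldExtType rat) d (w : 'I_d -> L) (sigma : 'I_d -> L -> R) :
  discrF w sigma = \det (\matrix_(i, j) sigma i (w j)) ^+ 2.
Proof.
rewrite /discrF /Rsqr RmultE -expr2; congr (_ ^+ 2).
apply: eq_bigr => s _; congr (_ * _); first by case: odd_perm.
by apply: eq_bigr => i _; rewrite mxE.
Qed.

(** The exponents sum to [0 + 1 + ... + n], and every [k > 0] contributes a factor 2. *)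
Lemma prod_cheb_coef_diag (F : realFieldType) (m h : F) n :
  \prod_(k < n.+1) cheb_coef m h k k = 2 ^+ n * (h / 2) ^+ 'C(n.+1, 2).
Proof.
elim: n => [|n IHn]; first by rewrite big_ord1 cheb_coef_diag !expr0 mulr1.
rewrite big_ord_recr IHn (_ : cheb_coef _ _ _ _ = cheb_coef m h n.+1 n.+1) //.
rewrite cheb_coef_diag /=.
rewrite ['C(n.+2, 2)]binS bin1 exprD [2 ^+ n.+1]exprS.
by rewrite -[_ ^+ n.+1 *+ _]mulr_natl mulrACA [2 ^+ n * 2]mulrC.
Qed.

Lemma prod_abs_cheb_coef_diag d n (a b : 'I_d -> R) : (forall i, a i < b i) ->
  \prod_(k < n.+1) \prod_s `|cheb_coef ((a s + b s) / 2) ((b s - a s) / 2) k k| =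
  2 ^+ (n * d) * (\prod_s ((b s - a s) / 4)) ^+ 'C(n.+1, 2).
Proof.
move=> lt_ab; rewrite exchange_big /=.
under eq_bigr => s _.
  rewrite -normr_prod prod_cheb_coef_diag ger0_norm.
    rewrite (_ : _ / 2 / 2 = (b s - a s) / 4); first over.
    by field.
  by rewrite mulr_ge0 ?exprn_ge0 // !divr_ge0 // subr_ge0 ltW.
by rewrite big_split /= prodr_const card_ord exprM prodrXl.
Qed.

(** Both sides are nonnegative, so they may be squared; the exponent [2 d (n + 1)] then clears the
    denominators [2 d] and [n + 1]. *)
Lemma radius_expr d n (D Q : R) : (0 < d)%N -> D != 0 -> 0 < Q ->
  (Rpower (Rabs (D ^+ 2)) (Rdiv R1 (INR (2 * d)))
   * Rpower (INR 2) (Rdiv (INR n) (INR n.+1))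
   * Rpower Q (Rdiv (INR n) (INR (2 * d)))) ^+ (d * n.+1) =
  `|D| ^+ n.+1 * (2 ^+ (n * d) * Q ^+ 'C(n.+1, 2)).
Proof.
move=> d_gt0 D_neq0 Q_gt0; have posR x y : 0 <= Rpower x y.
  by apply/ltW/RltP; exact: exp_pos.
have bin2 : ('C(n.+1, 2) * 2 = n * n.+1)%N.
  by rewrite mulnC -mul_bin_diag bin1 mulnC.
have d2_gt0 : (0 < 2 * d)%N by rewrite muln_gt0.
apply/eqP; rewrite -(@eqrXn2 _ 2) ?mulr_ge0 ?exprn_ge0 ?mulr_ge0 ?(ltW Q_gt0) //; apply/eqP.
have D2_gt0 : 0 < Rabs (D ^+ 2) by rewrite RabsE normr_gt0 expf_neq0.
have eD := Rpower_divn_expr 1 D2_gt0 d2_gt0.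
have eQ := Rpower_divn_expr n Q_gt0 d2_gt0.
have two_gt0 : 0 < INR 2 by rewrite INRE ltr0n.
have e2 := Rpower_divn_expr n two_gt0 (ltn0Sn n).
rewrite -exprM !exprMn.
have -> : (d * n.+1 * 2 = 2 * d * n.+1)%N by lia.
rewrite exprM eD [X in _ * _ * X]exprM eQ.
have -> : (2 * d * n.+1 = n.+1 * (2 * d))%N by lia.
rewrite [X in _ * X * _]exprM e2 expr1 RabsE normrX INRE -!exprM bin2.
by rewrite mulrA; congr (_ ^+ _ * _ ^+ _ * _); lia.
Qed.

(** The size may be smaller than [n], but the missing coefficients are zero. *)
Lemma peval_embE (L : fieldExtType rat) (s : L -> R) n (E : nat -> L) (x : R) :
  is_real_emb s -> peval_emb s (\poly_(j < n) E j) x = \sum_(j < n) s (E j) * x ^+ j.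
Proof.
move=> /real_emb_rmorphism[f fE].
rewrite /peval_emb; set P := \poly_(j < n) E j.
have le_n : (size P <= n)%N by exact: size_poly.
transitivity (\sum_(j < size P) s P`_j * x ^+ j).
  by apply: eq_bigr => j _; rewrite RpowE.
rewrite (big_ord_widen n (fun j => s P`_j * x ^+ j)) //.
rewrite [LHS]big_mkcond; apply: eq_bigr => j _.
case: ltnP => [_|le_j]; first by rewrite coef_poly ltn_ord.
have := coef_poly n E j; rewrite ltn_ord -/P nth_default // => <-.
by rewrite -fE rmorph0 mul0r.
Qed.

Theorem theorem6p1 (L : fieldExtType rat) (d : nat) (hd : \dim {:L} = d)
  (sigma : 'I_d -> L -> R)
  (hemb : forall i, is_real_emb (sigma i))
  (hinj : forall i j, (forall x, sigma i x = sigma j x) -> i = j)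
  (hall : forall s : L -> R, is_real_emb s -> exists i, forall x, s x = sigma i x)
  (w : 'I_d -> L) (hw : integral_basis w)
  (a b lam : 'I_d -> R)
  (hab : forall i, Rlt (a i) (b i))
  (hlam : forall i, Rlt R0 (lam i))
  (hprod : \big[Rmult/R1]_(i < d) lam i = R1)
  (n : nat) :
  exists P : {poly L},
    P != 0 /\ (forall j, integral P`_j) /\ (size P <= n.+1)%N /\
    forall i (x : R), Rle (a i) x -> Rle x (b i) ->
      Rle (Rabs (peval_emb (sigma i) P x))
          (Rmult (Rmult (Rmult (Rmult (lam i)
                   (Rpower (Rabs (discrF w sigma)) (Rdiv R1 (INR (2 * d)))))
                   (Rpower (INR 2) (Rdiv (INR n) (INR n.+1))))
                   (INR n.+1))
                 (Rpower (\big[Rmult/R1]_(k < d) Rdiv (Rminus (b k) (a k)) (INR 4))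
                         (Rdiv (INR n) (INR (2 * d))))).
Proof.
have d_gt0 : (0 < d)%N by rewrite -hd adim_gt0.
have lt_ab i : a i < b i by exact/RltP.
have lam_gt0 i : 0 < lam i by exact/RltP.
have nzD := det_real_emb_neq0 hd hw hemb hinj.
set D := \det _ in nzD.
pose Q := \prod_s ((b s - a s) / 4).
have Q_gt0 : 0 < Q by apply: prodr_gt0 => s _; rewrite divr_gt0 ?subr_gt0.
have -> : \big[Rmult/R1]_(k < d) Rdiv (Rminus (b k) (a k)) (INR 4) = Q.
  by apply: eq_bigr => k _; rewrite RdivE INRE.
rewrite discrFE -/D.
pose r := Rpower (Rabs (D ^+ 2)) (Rdiv R1 (INR (2 * d)))
   * Rpower (INR 2) (Rdiv (INR n) (INR n.+1))
   * Rpower Q (Rdiv (INR n) (INR (2 * d))).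
have r_gt0 : 0 < r by rewrite !mulr_gt0 //; apply/RltP; exact: exp_pos.
pose t s j k := cheb_coef ((a s + b s) / 2) ((b s - a s) / 2) j k.
have h_gt0 s : 0 < (b s - a s) / 2 by rewrite divr_gt0 ?subr_gt0.
pose W : 'M[R]_d := \matrix_(i, s) sigma s (w i).
have detW : \det W = D.
  by rewrite -det_tr; congr (\det _); apply/matrixP => i j; rewrite !mxE.
have [||||||c [c0 lec]] := @minkowski_matrix_forms R n d (fun s j k => t s j k) W
    (fun _ s => lam s * r).
- by [].
- move=> s j k; apply: contraR; rewrite -ltnNge => lt_jk.
  by rewrite /t cheb_coef_eq0.
- move=> s k; rewrite /t cheb_coef_diag mulrn_eq0 negb_or expf_neq0 ?andbT; last first.
    by rewrite gt_eqF // divr_gt0.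
  by case: (nat_of_ord k).
- by rewrite detW.
- by move=> _ s; rewrite mulr_gt0.
(* Equality holds: the left side is [r ^+ (d * n.+1)], and on the right the [lam s] multiply to 1
   for each [k]. *)
- rewrite detW prod_abs_cheb_coef_diag // -(radius_expr n d_gt0 nzD Q_gt0) -/r.
  under [leRHS]eq_bigr do rewrite big_split /= [X in X * _]hprod mul1r prodr_const card_ord.
  by rewrite prodr_const card_ord -exprM.
(* The default 0 only extends [E] to indices beyond [n]. *)
pose E j := \sum_(i < d) (if insub j is Some j' then c j' i else 0)%:~R * w i.
exists (\poly_(j < n.+1) E j).
have EE (j : 'I_n.+1) : E j = \sum_(i < d) (c j i)%:~R * w i by rewrite /E valK.
split; last split; last split.
- apply: contraNneq c0 => P0; apply/eqP/matrixP => j i; rewrite mxE.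
  apply: (integral_basis_eq0 hw (c := c j)); rewrite -EE.
  by have := coef_poly n.+1 E j; rewrite P0 coef0 ltn_ord.
- move=> j; rewrite coef_poly; case: ifP => _; first exact: integral_sumz.
  rewrite (_ : 0 = \sum_(i < d) 0%:~R * w i); first exact: integral_sumz.
  by rewrite big1 // => i _; rewrite mul0r.
- exact: size_poly.
move=> s x /RleP le_ax /RleP le_xb; apply/RleP.
pose y := (x - (a s + b s) / 2) / ((b s - a s) / 2).
have xE : x = (a s + b s) / 2 + (b s - a s) / 2 * y.
  by rewrite /y [_ * (_ / _)]mulrC divfK ?gt_eqF // addrC subrK.
have norm_y : `|y| <= 1.
  rewrite ler_norml ler_pdivlMr // ler_pdivrMr //; apply/andP; split; lra.
have [T [T0 T1 TS leT]] := chebyshev_values norm_y.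
rewrite peval_embE // RabsE.
have -> : \sum_(j < n.+1) sigma s (E j) * x ^+ j =
    \sum_(k < n.+1) (\sum_(j < n.+1) t s j k * (map_mx intr c *m W) j s) * T k.
  under [RHS]eq_bigr do rewrite mulr_suml.
  rewrite exchange_big; apply: eq_bigr => j _ /=.
  rewrite xE (cheb_expansion _ _ T0 T1 TS (ltn_ord j)) mulr_sumr.
  apply: eq_bigr => k _; rewrite mulrA; congr (_ * _); rewrite mulrC; congr (_ * _).
  rewrite EE real_emb_sumz // mxE; apply: eq_bigr => i _.
  by rewrite !mxE.
apply: (le_trans (ler_norm_sum _ _ _)).
(* Each of the [n + 1] Chebyshev terms is at most [lam s * r], which gives the factor [n + 1]. *)
apply: (@le_trans _ _ (\sum_(k < n.+1) lam s * r)).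
  apply: ler_sum => k _; rewrite normrM -[leRHS]mulr1.
  by rewrite ler_pM.
rewrite sumr_const card_ord -[leLHS]mulr_natr -INRE /r.
by rewrite ?RmultE le_eqVlt; apply/orP; left; apply/eqP; ring.
Qed.
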